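(* Let $\mathfrak{s}$ and $\mathfrak{s}'$ be two solvable (finite-dimensional, real) Lie algebras of the same dimension. Then $\mathfrak{s}$ and $\mathfrak{s}'$ are related via a sequence of shear constructions; that is, there is a finite sequence of Lie algebras $\mathfrak{g}_0=\mathfrak{s},\mathfrak{g}_1,\dots,\mathfrak{g}_N$ with $\mathfrak{g}_N\cong\mathfrak{s}'$ such that each $\mathfrak{g}_{i+1}$ is (isomorphic to) a shear of $\mathfrak{g}_i$.
   Context: Definition of a shear of a Lie algebra $\mathfrak{g}$. The data are: Abelian Lie algebras $\mathfrak{a}_G,\mathfrak{a}_P$ of the same dimension; a representation $\eta\in\mathfrak{g}^*\otimes\mathfrak{gl}(\mathfrak{a}_P)$ of $\mathfrak{g}$ on $\mathfrak{a}_P$; a two-form $\omega\in\Lambda^2\mathfrak{g}^*\otimes\mathfrak{a}_P$ with $d\omega=-\eta\wedge\omega$, where $d$ is the Chevalley--Eilenberg differential with trivial coefficients; an injective Lie algebra homomorphism $\xi\colon\mathfrak{a}_G\to\mathfrak{g}$; and an isomorphism $a\colon\mathfrak{a}_G\to\mathfrak{a}_P$. These define a Lie algebra $\mathfrak{p}=\mathfrak{g}\oplus\mathfrak{a}_P$ (as a vector space), in which $\mathfrak{a}_P$ is an Abelian ideal and $[X,Y]_{\mathfrak{p}}=[X,Y]_{\mathfrak{g}}-\omega(X,Y)$, $[X,Z]_{\mathfrak{p}}=\eta(X)Z$ for $X,Y\in\mathfrak{g}$, $Z\in\mathfrak{a}_P$. Put $\mathring\xi\colon\mathfrak{a}_G\to\mathfrak{p}$,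 $\mathring\xi Z=(\xi Z,aZ)$. Let $G$ be the simply-connected Lie group with Lie algebra $\mathfrak{g}$ and $E=G\times\mathfrak{a}_G$ the trivial bundle with connection $\nabla_Xe=X(e)+\gamma(X)e$, where $\gamma\in\mathfrak{g}^*\otimes\mathfrak{gl}(\mathfrak{a}_G)$ is $\gamma(X)Z=a^{-1}(\omega(\xi Z,X))+a^{-1}\eta(X)(aZ)$. View $\xi$ as a bundle map $E\to TG$ (constant sections go to left-invariant vector fields). For $\alpha\in\mathfrak{g}^*$ (a left-invariant one-form) put $\mathcal{L}^\nabla_\xi\alpha=d^\nabla(\xi\lrcorner\,\alpha)+\xi\lrcorner\,d\alpha$, an $E^*$-valued one-form, where $(\xi\lrcorner\,\alpha)(e)=\alpha(\xi e)$, $(\xi\lrcorner\,d\alpha)(X)(e)=d\alpha(\xi e,X)$ and $d^\nabla$ is the covariant exterior derivative of the induced connection on $E^*$. If (i) $[\xi e_1,\xi e_2]=\xi(\nabla_{\xi e_1}e_2-\nabla_{\xi e_2}e_1)$ for all $e_1,e_2\in\Gamma(E)$, (ii) $\xi^*\omega=0$, (iii) $\mathcal{L}^\nabla_\xi\alpha=0$ for all $\alpha\in\mathfrak{g}^*$, then $\mathring\xi(\mathfrak{a}_G)$ is an Abelian ideal of $\mathfrak{p}$ and the Lie algebra $\mathfrak{h}=\mathfrak{p}/\mathring\xi(\mathfrak{a}_G)$ is called the shear of $\mathfrak{g}$ (determined by the given data). *)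

(* Defs.v *)
From HB Require Import structures.
From mathcomp Require Import all_boot all_order all_algebra.
From mathcomp Require Import all_classical all_reals all_analysis.
From mathcomp Require Import ring.

Set Implicit Arguments.
Unset Strict Implicit.
Unset Printing Implicit Defensive.

Import Order.TTheory GRing.Theory Num.Theory.
Import numFieldNormedType.Exports.

Local Open Scope classical_set_scope.
Local Open Scope ring_scope.

Reserved Notation "[ 'lie' x , y ]" (format "[ 'lie'  x ,  y ]").

HB.mixin Record Vector_isLieAlgebra (R : fieldType) (V : Type)
    of Vector R V := {
  lie_bracket : V -> V -> V;
  lie_linearl : forall (k : R) (x y z : V),
    lie_bracket (k *: x + y) z = k *: lie_bracket x z + lie_bracket y z;
  lie_linearr : forall (k : R) (x y z : V),
    lie_bracket z (k *: x + y) = k *: lie_bracket z x + lie_bracket z y;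
  lie_alternating : forall x : V, lie_bracket x x = 0;
  lie_jacobi : forall x y z : V,
    lie_bracket x (lie_bracket y z) + lie_bracket y (lie_bracket z x)
    + lie_bracket z (lie_bracket x y) = 0
}.

#[short(type="lieAlgType")]
HB.structure Definition LieAlgebra (R : fieldType) :=
  {V of Vector_isLieAlgebra R V & Vector R V}.

Notation "[ 'lie' x , y ]" := (lie_bracket x y) : ring_scope.

Section LieTheory.
Variables (R : fieldType) (g : lieAlgType R).
Implicit Types (x y z : g) (U V W : {vspace g}) (k : R).

Lemma lieDl x y z : [lie x + y, z] = [lie x, z] + [lie y, z].
Proof. by have := lie_linearl 1 x y z; rewrite !scale1r. Qed.

Lemma lieDr x y z : [lie z, x + y] = [lie z, x] + [lie z, y].
Proof. by have := lie_linearr 1 x y z; rewrite !scale1r. Qed.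

Lemma lie0l x : [lie 0, x] = 0.
Proof. by apply: (addrI [lie 0, x]); rewrite -lieDl !addr0. Qed.

Lemma lie0r x : [lie x, 0] = 0.
Proof. by apply: (addrI [lie x, 0]); rewrite -lieDr !addr0. Qed.

Lemma lieZl k x y : [lie k *: x, y] = k *: [lie x, y].
Proof. by rewrite -[k *: x]addr0 lie_linearl lie0l addr0. Qed.

Lemma lieZr k x y : [lie y, k *: x] = k *: [lie y, x].
Proof. by rewrite -[k *: x]addr0 lie_linearr lie0r addr0. Qed.

Lemma lieNl x y : [lie - x, y] = - [lie x, y].
Proof. by rewrite -scaleN1r lieZl scaleN1r. Qed.

Lemma lieNr x y : [lie y, - x] = - [lie y, x].
Proof. by rewrite -scaleN1r lieZr scaleN1r. Qed.

Lemma lie_antisym x y : [lie x, y] = - [lie y, x].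
Proof.
apply/eqP; rewrite -addr_eq0; apply/eqP.
have := lie_alternating (x + y).
by rewrite lieDl !lieDr !lie_alternating add0r addr0.
Qed.

Lemma lie_suml (I : Type) (r : seq I) (P : pred I) (F : I -> g) y :
  [lie \sum_(i <- r | P i) F i, y] = \sum_(i <- r | P i) [lie F i, y].
Proof.
by elim/big_rec2: _ => [|i u v _ <-]; rewrite ?lie0l// lieDl.
Qed.

Lemma lie_sumr (I : Type) (r : seq I) (P : pred I) (F : I -> g) y :
  [lie y, \sum_(i <- r | P i) F i] = \sum_(i <- r | P i) [lie y, F i].
Proof.
by elim/big_rec2: _ => [|i u v _ <-]; rewrite ?lie0r// lieDr.
Qed.

(* Brackets of basis vectors suffice, by bilinearity: see [liev_prodP]. *)
Definition liev_prod U V : {vspace g} :=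
  <<[seq [lie u, v] | u <- vbasis U, v <- vbasis V]>>%VS.

Lemma liev_prodP U V W :
  reflect (forall u v, u \in U -> v \in V -> [lie u, v] \in W)
          (liev_prod U V <= W)%VS.
Proof.
apply: (iffP idP) => [sUVW u v Uu Vv|sUVW].
  rewrite (coord_vbasis Uu) (coord_vbasis Vv) lie_suml memv_suml// => i _.
  rewrite lie_sumr memv_suml// => j _; rewrite lieZl lieZr !memvZ//.
  apply: (subvP sUVW); apply/memv_span/allpairs_f; exact: memt_nth.
by apply/span_subvP => _ /allpairsP[[u v] /= [Uu Vv ->]];
  apply: sUVW; apply: vbasis_mem.
Qed.

Definition derived_series (k : nat) : {vspace g} :=
  iter k (fun U => liev_prod U U) fullv.

Definition lie_solvable : Prop := exists k : nat, derived_series k = 0%VS.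

Definition lie_abelian : Prop := forall x y, [lie x, y] = 0.

End LieTheory.

Arguments derived_series {R} g k.
Arguments lie_solvable {R} g.
Arguments lie_abelian {R} g.

Definition lie_morphism (R : fieldType) (g h : lieAlgType R) (f : 'Hom(g, h)) :=
  forall x y, f [lie x, y] = [lie f x, f y].

Definition lie_isomorphic (R : fieldType) (g h : lieAlgType R) : Prop :=
  exists f : 'Hom(g, h), bijective f /\ lie_morphism f.

Section ChevalleyEilenberg.
Variables (R : fieldType) (g : lieAlgType R) (V : vectType R).

(* Chevalley--Eilenberg differential with trivial coefficients and wedge
   product of forms, normalized as sums over shuffles (no factorials). *)
Definition ce_d1 (alpha : g -> V) (x y : g) : V := - alpha [lie x, y].

Definition ce_d2 (omega : g -> g -> V) (x y z : g) : V :=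
  - omega [lie x, y] z + omega [lie x, z] y - omega [lie y, z] x.

Definition wedge12 (eta : g -> 'End(V)) (omega : g -> g -> V) (x y z : g) : V :=
  eta x (omega y z) - eta y (omega x z) + eta z (omega x y).

End ChevalleyEilenberg.

Section Smooth.
Variable R : realType.

(* [Ck_on k U f]: f is k times continuously differentiable on U, which is
   meant to be open. *)
Fixpoint Ck_on (V W : normedModType R) (k : nat) (U : set V) (f : V -> W)
    {struct k} : Prop :=
  match k with
  | 0 => forall x, U x -> {for x, continuous f}
  | k'.+1 => (forall x, U x -> differentiable f x) /\
             (forall v : V, Ck_on k' U (fun x => 'D_v f x))
  end.

Definition smooth_on (V W : normedModType R) (U : set V) (f : V -> W) : Prop :=
  forall k, Ck_on k U f.

(* [chart_map] and [chart_inv] are total, but only meaningful on [chart_dom]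
   and [chart_cod] respectively. *)
Record chart (n : nat) (M : topologicalType) := Chart {
  chart_dom : set M;
  chart_cod : set 'rV[R]_n;
  chart_map : M -> 'rV[R]_n;
  chart_inv : 'rV[R]_n -> M;
  chart_dom_open : open chart_dom;
  chart_cod_open : open chart_cod;
  chart_mapP : forall p, chart_dom p -> chart_cod (chart_map p);
  chart_invP : forall x, chart_cod x -> chart_dom (chart_inv x);
  chart_mapK : forall p, chart_dom p -> chart_inv (chart_map p) = p;
  chart_invK : forall x, chart_cod x -> chart_map (chart_inv x) = x;
  chart_map_continuous : forall p, chart_dom p -> {for p, continuous chart_map};
  chart_inv_continuous : forall x, chart_cod x -> {for x, continuous chart_inv}
}.

Definition is_smooth_atlas (n : nat) (M : topologicalType)
    (A : set (chart n M)) : Prop :=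
  (forall p, exists2 c, A c & chart_dom c p) /\
  (forall c1 c2, A c1 -> A c2 ->
     smooth_on (chart_cod c1 `&` chart_inv c1 @^-1` chart_dom c2)
       (chart_map c2 \o chart_inv c1)).

End Smooth.

HB.structure Definition GroupTopological := {G of Group G & Topological G}.

Record lieGroup (R : realType) (n : nat) := LieGroup {
  lieGroup_sort :> GroupTopological.type;
  lieGroup_hausdorff : hausdorff_space lieGroup_sort;
  lieGroup_second_countable : @second_countable lieGroup_sort;
  lieGroup_atlas : set (chart R n lieGroup_sort);
  lieGroup_atlasP : is_smooth_atlas lieGroup_atlas;
  lieGroup_mul_continuous :
    continuous (fun p : lieGroup_sort * lieGroup_sort => (p.1 * p.2)%g);
  lieGroup_inv_continuous : continuous (fun p : lieGroup_sort => p^-1%g);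
  lieGroup_mul_smooth : forall c1 c2 c3,
    lieGroup_atlas c1 -> lieGroup_atlas c2 -> lieGroup_atlas c3 ->
    smooth_on
      ((chart_cod c1 `*` chart_cod c2) `&`
       [set u : 'rV[R]_n * 'rV[R]_n |
          chart_dom c3 (chart_inv c1 u.1 * chart_inv c2 u.2)%g])
      (fun u : 'rV[R]_n * 'rV[R]_n =>
         chart_map c3 (chart_inv c1 u.1 * chart_inv c2 u.2)%g);
  lieGroup_inv_smooth : forall c1 c2, lieGroup_atlas c1 -> lieGroup_atlas c2 ->
    smooth_on
      (chart_cod c1 `&`
       [set x : 'rV[R]_n | chart_dom c2 (chart_inv c1 x)^-1%g])
      (fun x : 'rV[R]_n => chart_map c2 (chart_inv c1 x)^-1%g)
}.

(* Path-connected, and any two paths with the same endpoints are homotopic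
   relative to these endpoints. *)
Definition simply_connected (R : realType) (M : topologicalType) : Prop :=
  (forall p q : M, exists c : R -> M,
     [/\ {within `[0, 1], continuous c}, c 0 = p & c 1 = q]) /\
  (forall c0 c1 : R -> M,
     {within `[0, 1], continuous c0} -> {within `[0, 1], continuous c1} ->
     c0 0 = c1 0 -> c0 1 = c1 1 ->
     exists H : R * R -> M,
       [/\ {within `[0, 1] `*` `[0, 1], continuous H},
           forall t, t \in `[0, 1]%R -> H (0, t) = c0 t /\ H (1, t) = c1 t &
           forall s, s \in `[0, 1]%R -> H (s, 0) = c0 0 /\ H (s, 1) = c0 1]).

Section LieGroupCalculus.
Variables (R : realType) (n : nat) (G : lieGroup R n).

Definition smooth_fun (f : G -> R^o) : Prop :=
  forall c, lieGroup_atlas c -> smooth_on (chart_cod c) (f \o chart_inv c).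

Definition smooth_map (V : vectType R) (e : G -> V) : Prop :=
  forall phi : 'Hom(V, R^o), smooth_fun (phi \o e).

(* Vector fields on G as derivations of C^oo(G); the values of D outside
   C^oo(G) are irrelevant. *)
Definition is_derivation (D : (G -> R^o) -> (G -> R^o)) : Prop :=
  [/\ forall f, smooth_fun f -> smooth_fun (D f),
      forall (k : R) f1 f2, smooth_fun f1 -> smooth_fun f2 ->
        forall p, D (fun q => k * f1 q + f2 q) p = k * D f1 p + D f2 p &
      forall f1 f2, smooth_fun f1 -> smooth_fun f2 ->
        forall p, D (fun q => f1 q * f2 q) p = D f1 p * f2 p + f1 p * D f2 p].

Definition left_invariant (D : (G -> R^o) -> (G -> R^o)) : Prop :=
  forall a f, smooth_fun f ->
    forall p, D (fun q => f (a * q)%g) p = D f (a * p)%g.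

(* g is the Lie algebra of G: L is a Lie algebra isomorphism from g onto the
   left-invariant vector fields on G. *)
Record is_lie_algebra_of (g : lieAlgType R)
    (L : g -> (G -> R^o) -> (G -> R^o)) : Prop := {
  lie_of_derivation : forall x, is_derivation (L x);
  lie_of_invariant : forall x, left_invariant (L x);
  lie_of_linear : forall (k : R) x y f, smooth_fun f ->
    forall p, L (k *: x + y) f p = k * L x f p + L y f p;
  lie_of_bracket : forall x y f, smooth_fun f ->
    forall p, L [lie x, y] f p = L x (L y f) p - L y (L x f) p;
  lie_of_injective : forall x y,
    (forall f, smooth_fun f -> forall p, L x f p = L y f p) -> x = y;
  lie_of_surjective : forall D, is_derivation D -> left_invariant D ->
    exists x, forall f, smooth_fun f -> forall p, D f p = L x f p
}.

Variables (g : lieAlgType R) (L : g -> (G -> R^o) -> (G -> R^o)).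

(* A vector field on G is given, in the left trivialization of TG, by a smooth
   map X : G -> g: it is the field p |-> (L (X p))_p. *)
Definition vf_apply (X : G -> g) (f : G -> R^o) : G -> R^o :=
  fun p => L (X p) f p.

Definition vf_commutator (X Y : G -> g) (f : G -> R^o) : G -> R^o :=
  fun p => vf_apply X (vf_apply Y f) p - vf_apply Y (vf_apply X f) p.

(* Componentwise derivative of a V-valued function *)
Definition vf_applyV (V : vectType R) (X : G -> g) (e : G -> V) : G -> V :=
  fun p => \sum_(i < \dim {:V})
    vf_apply X (fun q => coord (vbasis {:V}) i (e q)) p *: (vbasis {:V})`_i.

End LieGroupCalculus.

Record shear_data (R : realType) (g : lieAlgType R) := ShearData {
  sh_aG : lieAlgType R;
  sh_aP : lieAlgType R;
  sh_aG_abelian : lie_abelian sh_aG;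
  sh_aP_abelian : lie_abelian sh_aP;
  sh_dim : \dim {: sh_aG} = \dim {: sh_aP};
  sh_eta : 'Hom(g, 'End(sh_aP));
  sh_eta_rep : forall x y z,
    sh_eta [lie x, y] z = sh_eta x (sh_eta y z) - sh_eta y (sh_eta x z);
  sh_omega : g -> g -> sh_aP;
  sh_omega_linearl : forall y, linear (fun x => sh_omega x y);
  sh_omega_linearr : forall x, linear (sh_omega x);
  sh_omega_alternating : forall x, sh_omega x x = 0;
  sh_domega : forall x y z,
    ce_d2 sh_omega x y z = - wedge12 sh_eta sh_omega x y z;
  sh_xi : 'Hom(sh_aG, g);
  sh_xi_morphism : lie_morphism sh_xi;
  sh_xi_injective : injective sh_xi;
  sh_a : 'Hom(sh_aG, sh_aP);
  sh_a_bijective : bijective sh_a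
}.

(* The aP-component of the Jacobi identity of the extension p below. *)
Lemma twisted_jacobi (R : fieldType) (g : lieAlgType R) (V : vectType R)
    (w : g -> g -> V) (e : g -> V -> V) (x1 y1 z1 : g) (x2 y2 z2 : V) :
  (forall x y, w x y = - w y x) -> (forall x y, w x (- y) = - w x y) ->
  (forall x u v, e x (u + v) = e x u + e x v) ->
  (forall x u, e x (- u) = - e x u) ->
  (forall x y u, e [lie x, y] u = e x (e y u) - e y (e x u)) ->
  (forall x y z,
     - w [lie x, y] z + w [lie x, z] y - w [lie y, z] x
     = - (e x (w y z) - e y (w x z) + e z (w x y))) ->
  let br (x y : g) (u v : V) := - w x y + e x v - e y u in
  br x1 [lie y1, z1] x2 (br y1 z1 y2 z2)
  + br y1 [lie z1, x1] y2 (br z1 x1 z2 x2)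
  + br z1 [lie x1, y1] z2 (br x1 y1 x2 y2) = 0.
Proof.
move=> wC wN eD eN eL dw br; rewrite /br !eD !eN !eL.
have := dw x1 y1 z1; rewrite (wC x1 z1) eN (lie_antisym z1 x1) wN.
rewrite -(wC [lie x1, z1]) (wC x1 [lie _, _]) (wC z1 [lie _, _]) !opprK.
set a := w _ _; set b := w _ _; set c := w _ _.
set p := e _ _; set q := e _ _; set r := e _ _ => H.
have {H}-> : a = b - c + (p + q + r).
  have -> : p + q + r = a - (b - c) by rewrite -[LHS]opprK -H -addrA opprD opprK.
  by rewrite [RHS]addrC subrK.
set t1 := e _ (e _ _); set t2 := e _ (e _ _); set t3 := e _ (e _ _).
set t4 := e _ (e _ _); set t5 := e _ (e _ _); set t6 := e _ (e _ _).

set lhs := (X in X = 0); rewrite (coord_vbasis (memvf lhs)).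
rewrite big1 // => i _; rewrite -[RHS](scale0r (vbasis fullv)`_i).
congr (_ *: _); rewrite {}/lhs; set f := coord _ _.
have fD u v : f (u + v) = f u + f v by exact: linearD.
have fN u : f (- u) = - f u by exact: linearN.
by rewrite !(fD, fN); ring.
Qed.

(* The Lie algebra p: elements are pairs (X, Z) with X in g, Z in aP. *)
Section ShearExtension.
Variables (R : realType) (g : lieAlgType R) (D : shear_data g).

Definition shear_ext : Type := (g * sh_aP D)%type.
HB.instance Definition _ := Vector.on shear_ext.

Definition shear_ext_bracket (u v : shear_ext) : shear_ext :=
  ([lie u.1, v.1],
   - sh_omega D u.1 v.1 + sh_eta D u.1 v.2 - sh_eta D v.1 u.2).

Lemma shear_ext_linearl (k : R) (x y z : shear_ext) :
  shear_ext_bracket (k *: x + y) z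
  = k *: shear_ext_bracket x z + shear_ext_bracket y z.
Proof.
case: x y z => [x1 x2] [y1 y2] [z1 z2]; congr pair => /=.
  exact: lie_linearl.
have := sh_omega_linearl D z1 k x1 y1 => /= ->.
rewrite !linearP /= add_lfunE scale_lfunE !scalerDr.
by rewrite [X in X + _ = _]addrACA [LHS]addrACA.
Qed.

Lemma shear_omega_antisym (x y : g) : sh_omega D x y = - sh_omega D y x.
Proof.
have Dl u v w : sh_omega D (u + v) w = sh_omega D u w + sh_omega D v w.
  by have := sh_omega_linearl D w 1 u v; rewrite /= !scale1r.
have Dr u v w : sh_omega D w (u + v) = sh_omega D w u + sh_omega D w v.
  by have := sh_omega_linearr D w 1 u v; rewrite /= !scale1r.
apply/eqP; rewrite -addr_eq0; apply/eqP.
have := sh_omega_alternating D (x + y).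
by rewrite Dl !Dr !sh_omega_alternating add0r addr0.
Qed.

Lemma shear_omegaNr (x y : g) : sh_omega D x (- y) = - sh_omega D x y.
Proof.
have D0 : sh_omega D x 0 = 0.
  have := sh_omega_linearr D x 1 0 0; rewrite /= !scale1r addr0.
  by move/eqP; rewrite -subr_eq subrr => /eqP <-.
have := sh_omega_linearr D x (-1) y 0.
by rewrite /= !addr0 D0 addr0 !scaleN1r.
Qed.

Lemma shear_ext_skew (u v : shear_ext) :
  shear_ext_bracket u v = - shear_ext_bracket v u.
Proof.
case: u v => [x1 x2] [y1 y2]; congr pair => /=; first exact: lie_antisym.
by rewrite shear_omega_antisym !opprD !opprK -!addrA [X in _ + X]addrC.
Qed.

Lemma shear_ext_linearr (k : R) (x y z : shear_ext) :
  shear_ext_bracket z (k *: x + y)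
  = k *: shear_ext_bracket z x + shear_ext_bracket z y.
Proof.
rewrite shear_ext_skew shear_ext_linearl opprD -scalerN.
by rewrite -!shear_ext_skew.
Qed.

Lemma shear_ext_alternating (x : shear_ext) : shear_ext_bracket x x = 0.
Proof.
case: x => [x1 x2]; congr pair => /=; first exact: lie_alternating.
by rewrite sh_omega_alternating oppr0 add0r subrr.
Qed.

Lemma shear_ext_jacobi (x y z : shear_ext) :
  shear_ext_bracket x (shear_ext_bracket y z)
  + shear_ext_bracket y (shear_ext_bracket z x)
  + shear_ext_bracket z (shear_ext_bracket x y) = 0.
Proof.
case: x y z => [x1 x2] [y1 y2] [z1 z2]; congr pair => /=.
  exact: lie_jacobi.
apply: (@twisted_jacobi R g _ (sh_omega D) (fun x => sh_eta D x)) => *.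
- exact: shear_omega_antisym.
- exact: shear_omegaNr.
- exact: linearD.
- exact: linearN.
- exact: sh_eta_rep.
- exact: sh_domega.
Qed.

HB.instance Definition _ := Vector_isLieAlgebra.Build R shear_ext
  shear_ext_linearl shear_ext_linearr shear_ext_alternating shear_ext_jacobi.

Definition shear_xi_ring (z : sh_aG D) : shear_ext := (sh_xi D z, sh_a D z).

Definition shear_gamma (x : g) (z : sh_aG D) : sh_aG D :=
  (sh_a D)^-1%VF (sh_omega D (sh_xi D z) x)
  + (sh_a D)^-1%VF (sh_eta D x (sh_a D z)).

(* Sections of E = G x aG are smooth maps G -> aG. *)
Section Conditions.
Variables (n : nat) (G : lieGroup R n) (L : g -> (G -> R^o) -> (G -> R^o)).

Definition shear_nabla (X : G -> g) (e : G -> sh_aG D) : G -> sh_aG D :=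
  fun p => vf_applyV L X e p + shear_gamma (X p) (e p).

(* The induced connection on E^*, paired with a section e of E:
   (nabla_X s)(e) = X(s(e)) - s(nabla_X e). *)
Definition shear_nabla_dual (X : G -> g) (s : G -> 'Hom(sh_aG D, R^o))
    (e : G -> sh_aG D) : G -> R :=
  fun p => vf_apply L X (fun q => s q (e q)) p - s p (shear_nabla X e p).

(* For left-invariant alpha, (L^nabla_xi alpha)(X)(e), with d^nabla the
   covariant derivative on sections of E^*. *)
Definition shear_lie_nabla (alpha : 'Hom(g, R^o)) (X : G -> g)
    (e : G -> sh_aG D) : G -> R :=
  fun p => shear_nabla_dual X (fun=> (alpha \o sh_xi D)%VF) e p
           + ce_d1 alpha (sh_xi D (e p)) (X p).

Definition shear_torsion_condition : Prop :=
  forall e1 e2 : G -> sh_aG D, smooth_map e1 -> smooth_map e2 ->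
  let xe1 := sh_xi D \o e1 in let xe2 := sh_xi D \o e2 in
  forall f, smooth_fun f -> forall p,
    vf_commutator L xe1 xe2 f p
    = vf_apply L
        (fun q => sh_xi D (shear_nabla xe1 e2 q - shear_nabla xe2 e1 q)) f p.

Definition shear_lie_condition : Prop :=
  forall (alpha : 'Hom(g, R^o)) (X : G -> g) (e : G -> sh_aG D),
    smooth_map X -> smooth_map e ->
    forall p, shear_lie_nabla alpha X e p = 0.

End Conditions.

(* "The" simply-connected Lie group with Lie algebra g exists by Lie's third
   theorem and is unique up to isomorphism; the conditions are required of
   every such G, and of every identification L of g with the left-invariant
   vector fields on G. *)
Definition shear_conditions : Prop :=
  (forall z1 z2, sh_omega D (sh_xi D z1) (sh_xi D z2) = 0) /\
  (forall (n : nat) (G : lieGroup R n) (L : g -> (G -> R^o) -> (G -> R^o)),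
     simply_connected R G -> is_lie_algebra_of L ->
     shear_torsion_condition L /\ shear_lie_condition L).

End ShearExtension.

(* h is isomorphic to p / I, where I is the image of shear_xi_ring. *)
Definition is_shear_quotient (R : realType) (g : lieAlgType R)
    (D : shear_data g) (h : lieAlgType R) : Prop :=
  exists pi : 'Hom(shear_ext D, h),
    [/\ lie_morphism pi,
        forall y, exists u, pi u = y &
        forall u, pi u = 0 <-> exists z, u = shear_xi_ring z].

Definition is_shear (R : realType) (g h : lieAlgType R) : Prop :=
  exists D : shear_data g, shear_conditions D /\ is_shear_quotient D h.

(* Main.v *)
From HB Require Import structures.
Require Import Defs.
From mathcomp Require Import all_boot all_order all_algebra.
From mathcomp Require Import all_classical all_reals all_analysis.

Set Implicit Arguments.
Unset Strict Implicit.
Unset Printing Implicit Defensive.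

Import Order.TTheory GRing.Theory Num.Theory.
Import numFieldNormedType.Exports.

Local Open Scope ring_scope.

(** A shear replaces an abelian ideal together with its extension data and
leaves the quotient alone. If V is an abelian ideal of g and h is an extension
of g/V by an abelian ideal of dimension dim V, then h is a shear of g: the Lie
algebra p is the fibre product of g and h over g/V, written with respect to a
well-chosen linear section of p -> g. In [is_shear_along_ideal] such an h is
presented by a linear bijection s : g -> h that carries V onto an abelian ideal
and is a morphism modulo that ideal. This description is symmetric in g and h,
so that shears of this kind can be undone by shears.

Let g be solvable and A the last nonzero term of its derived series, an
abelian ideal. Both g and the split algebra g/A (+) A are extensions of g/A by
an abelian ideal of dimension dim A, so each is a shear of the other, and the
split algebra has a shorter derived series unless g is abelian. By induction g
and an abelian Lie algebra of the same dimension are joined by shears in both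
directions ([solvable_shear_abelian]). Two abelian Lie algebras of the same
dimension are shears of each other, the ideal being everything. Going down from
s to an abelian algebra, across, and up to s' gives the sequence.

Conditions (i) and (iii) in the definition of a shear concern arbitrary smooth
sections over the simply-connected group. They are tensorial: expanding a
section in a basis and using the Leibniz rule, the terms in which a section is
differentiated cancel, and both conditions reduce to the algebraic identity
xi (gamma X z) = [X, xi z] ([shear_conditions_of_gamma]). The Leibniz
rule is available for smooth functions only, so one has to know that sums and
products of smooth functions are smooth. *)

(** * Sums and products of C^k functions *)

Section CkFunctions.
Variables (R : realType) (V : normedModType R).
Implicit Types (W : normedModType R) (U : set V) (x : V).
Local Open Scope classical_set_scope.

Lemma near0_differentiable W (z : V -> W) x :
  (\forall y \near x, z y = 0) -> differentiable z x.
Proof.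
move=> z0; have zo : z =o_x (center x).
  apply/eqoP => _/posnumP[e]; near=> t.
  by rewrite (near z0 t) // normr0 mulr_ge0.
apply/diffP.
apply: (@getPex _ (fun (df : {linear V -> W}) => continuous df /\
  forall y, z y = z (lim (nbhs x)) + df (y - lim (nbhs x))
                  +o_(y \near x) (y - lim (nbhs x)))).
exists (\0 : {linear V -> W})%R; split; first by move=> y; exact: cvg_cst.
apply: eqaddoEx => y; rewrite lim_id // (nbhs_singleton z0) /= !add0r.
by rewrite {1}zo.
Unshelve. all: by end_near. Qed.

(** Differentiability is defined through a little-o expansion at the point; it
is local because the difference of two functions that agree near x satisfies
such an expansion with zero differential. *)
Lemma near_eq_differentiable W (f h : V -> W) x :
  (\forall y \near x, f y = h y) -> differentiable f x -> differentiable h x.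
Proof.
move=> fh df; have -> : h = f + (h - f) by rewrite addrC subrK.
apply: differentiableD => //; apply: near0_differentiable.
by apply: filterS fh => y /= fhy; rewrite !fctE fhy subrr.
Qed.

(** The sum and product rules identify the derivatives of f + h and f * h on U
only, whereas the next derivative involves a neighbourhood; openness of U
bridges the two. *)
Lemma eq_Ck_on W k U (f h : V -> W) : open U ->
  (forall x, U x -> f x = h x) -> Ck_on k U f -> Ck_on k U h.
Proof.
move=> oU; elim: k f h => [|k IHk] f h fh.
  move=> Cf x Ux.
  have fhx : \forall y \near x, f y = h y.
    by apply: filterS fh _; exact: open_nbhs_nbhs.
  rewrite /prop_for /continuous_at -(fh x Ux).
  by apply: cvg_trans (Cf x Ux); apply: near_eq_cvg.
have fhx x : U x -> \forall y \near x, f y = h y.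
  by move=> Ux; apply: filterS fh _; exact: open_nbhs_nbhs.
move=> [df Cf]; split=> [x Ux|v].
  by apply: near_eq_differentiable (df x Ux); exact: fhx.
apply: IHk (Cf v) => x Ux; apply: near_eq_derive; exact: fhx.
Qed.

Lemma Ck_onW W k U (f : V -> W) : Ck_on k.+1 U f -> Ck_on k U f.
Proof.
elim: k f => [|k IHk] f [df Cf].
  by move=> x Ux; apply: differentiable_continuous; exact: df.
by split=> // v; apply: IHk; exact: Cf.
Qed.

Lemma Ck_on_cst W k U (c : W) : Ck_on k U (cst c).
Proof.
elim: k c => [|k IHk] c; first by move=> x Ux; exact: cst_continuous.
split=> [x Ux|v]; first exact: differentiable_cst.
have -> : (fun x : V => 'D_v (cst c) x) = cst 0 by apply/funext => x; rewrite derive_cst.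
exact: IHk.
Qed.

Lemma Ck_onD W k U (f h : V -> W) : open U ->
  Ck_on k U f -> Ck_on k U h -> Ck_on k U (f + h).
Proof.
move=> oU; elim: k f h => [|k IHk] f h.
  by move=> Cf Ch x Ux; apply: continuousD; [exact: Cf|exact: Ch].
move=> [df Cf] [dh Ch]; split=> [x Ux|v].
  by apply: differentiableD; [exact: df|exact: dh].
apply: eq_Ck_on (IHk _ _ (Cf v) (Ch v)) => // x Ux; rewrite deriveD //.
  by apply: diff_derivable; exact: df.
by apply: diff_derivable; exact: dh.
Qed.

Lemma Ck_onM k U (f h : V -> R^o) : open U ->
  Ck_on k U f -> Ck_on k U h -> Ck_on k U (f * h).
Proof.
move=> oU; elim: k f h => [|k IHk] f h.
  by move=> Cf Ch x Ux; apply: continuousM; [exact: Cf|exact: Ch].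
move=> fk hk; have [[df Cf] [dh Ch]] := (fk, hk); split=> [x Ux|v].
  by apply: differentiableM; [exact: df|exact: dh].
have Cfh : Ck_on k U (f * 'D_v h + h * 'D_v f).
  by apply: Ck_onD => //; apply: IHk => //; by [apply: Ck_onW | exact: Cf | exact: Ch].
apply: eq_Ck_on Cfh => // x Ux; rewrite deriveM //.
  by apply: diff_derivable; exact: df.
by apply: diff_derivable; exact: dh.
Qed.

End CkFunctions.

(** * Smooth functions on a Lie group and their derivations *)

Section SmoothFunctions.
Variables (R : realType) (n : nat) (G : lieGroup R n).

Lemma smooth_cst (k : R) : smooth_fun (fun _ : G => k).
Proof. by move=> c _ k'; exact: Ck_on_cst. Qed.

Lemma smoothD (f1 f2 : G -> R^o) :
  smooth_fun f1 -> smooth_fun f2 -> smooth_fun (fun q => f1 q + f2 q).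
Proof.
move=> s1 s2 c Ac k; exact: (Ck_onD (@chart_cod_open _ _ _ c) (s1 c Ac k) (s2 c Ac k)).
Qed.

Lemma smoothM (f1 f2 : G -> R^o) :
  smooth_fun f1 -> smooth_fun f2 -> smooth_fun (fun q => f1 q * f2 q).
Proof.
move=> s1 s2 c Ac k; exact: (Ck_onM (@chart_cod_open _ _ _ c) (s1 c Ac k) (s2 c Ac k)).
Qed.

Lemma smooth_sum (I : Type) (r : seq I) (F : I -> G -> R^o) :
  (forall i, smooth_fun (F i)) -> smooth_fun (fun q => \sum_(i <- r) F i q).
Proof.
move=> sF; elim: r => [|i r IHr].
  by under eq_fun do rewrite big_nil; exact: smooth_cst.
by under eq_fun do rewrite big_cons; exact: smoothD.
Qed.

End SmoothFunctions.

Section Derivations.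
Variables (R : realType) (n : nat) (G : lieGroup R n).
Variables (D : (G -> R^o) -> G -> R^o) (DD : is_derivation D).

Lemma derivationD (f1 f2 : G -> R^o) p : smooth_fun f1 -> smooth_fun f2 ->
  D (fun q => f1 q + f2 q) p = D f1 p + D f2 p.
Proof.
case: DD => _ Dlin _ s1 s2; have := Dlin 1 f1 f2 s1 s2 p.
by rewrite mul1r => <-; congr D; apply/funext => q; rewrite mul1r.
Qed.

Lemma derivation0 p : D (fun=> 0) p = 0.
Proof.
apply: (addrI (D (fun=> 0) p)); rewrite -derivationD ?addr0; try exact: smooth_cst.
by congr D; apply/funext => q; rewrite addr0.
Qed.

Lemma derivationZ (k : R) (f : G -> R^o) p : smooth_fun f ->
  D (fun q => k * f q) p = k * D f p.
Proof.
case: DD => _ Dlin _ sf; have := Dlin k f _ sf (@smooth_cst _ _ _ 0) p.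
by rewrite derivation0 addr0 => <-; congr D; apply/funext => q; rewrite addr0.
Qed.

Lemma derivation_sum (I : Type) (r : seq I) (F : I -> G -> R^o) p :
  (forall i, smooth_fun (F i)) ->
  D (fun q => \sum_(i <- r) F i q) p = \sum_(i <- r) D (F i) p.
Proof.
move=> sF; elim: r => [|i r IHr].
  by under eq_fun do rewrite big_nil; rewrite big_nil derivation0.
under eq_fun do rewrite big_cons; rewrite big_cons derivationD ?IHr //.
exact: smooth_sum.
Qed.

End Derivations.

(** * Differentiating sections in the left trivialization *)

Section LeftInvariantCalculus.
Variables (R : realType) (n : nat) (G : lieGroup R n).
Variables (g : lieAlgType R) (L : g -> (G -> R^o) -> (G -> R^o)).
Hypothesis HL : is_lie_algebra_of L.

Lemma smooth_coord (V : vectType R) (e : G -> V) i : smooth_map e ->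
  smooth_fun (fun q => coord (vbasis {:V}) i (e q)).
Proof.
move=> /(_ (linfun (coord (vbasis {:V}) i : V -> R^o))) se c Ac k.
by have := se c Ac k; congr Ck_on; apply/funext => x /=; rewrite lfunE.
Qed.

Lemma lie_of_sum (I : finType) (c : I -> R) (x : I -> g) f p : smooth_fun f ->
  L (\sum_i c i *: x i) f p = \sum_i c i * L (x i) f p.
Proof.
move=> sf; have L0 : L 0 f p = 0.
  apply: (addrI (L 0 f p)); have := lie_of_linear HL 1 0 0 sf p.
  by rewrite scale1r mul1r !addr0 => <-.
elim/big_rec2: _ => [//|i a b _ <-]; exact: (lie_of_linear HL).
Qed.

Lemma lfun_vf_applyV (V : vectType R) (W : vectType R) (phi : 'Hom(V, W)) 
    (X : G -> g) (e : G -> V) p :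
  phi (vf_applyV L X e p) = \sum_(i < \dim {:V})
    vf_apply L X (fun q => coord (vbasis {:V}) i (e q)) p
    *: phi (vbasis {:V})`_i.
Proof. by rewrite linear_sum; apply: eq_bigr => i _; rewrite linearZ. Qed.

(** Componentwise differentiation commutes with linear functionals; this makes
it independent of the basis. *)
Lemma vf_apply_lfun (V : vectType R) (phi : 'Hom(V, R^o)) (X : G -> g)
    (e : G -> V) p : smooth_map e ->
  vf_apply L X (fun q => phi (e q)) p = phi (vf_applyV L X e p).
Proof.
move=> se; rewrite lfun_vf_applyV.
have -> : (fun q => phi (e q)) = (fun q => \sum_(i < \dim {:V})
    phi (vbasis {:V})`_i * coord (vbasis {:V}) i (e q)).
  apply/funext => q; rewrite {1}(coord_vbasis (memvf (e q))) linear_sum.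
  by apply: eq_bigr => i _; rewrite linearZ /= mulrC.
have DX := lie_of_derivation HL (X p).
rewrite /vf_apply (derivation_sum DX) => [|i]; last first.
  by apply: smoothM; [exact: smooth_cst|exact: smooth_coord].
apply: eq_bigr => i _; rewrite (derivationZ DX) 1?mulrC //; exact: smooth_coord.
Qed.

(** Leibniz rule for the second-order operator X(Y f), where Y = xi e: the first
term differentiates the coefficients of Y, the second treats X and Y as the
left-invariant fields with values X p and Y p. In a commutator the second
terms combine to the Lie bracket of these values. *)
Lemma vf_apply_apply (V : vectType R) (xi : 'Hom(V, g)) (X : G -> g)
    (e : G -> V) f p : smooth_map e -> smooth_fun f ->
  vf_apply L X (vf_apply L (xi \o e) f) p
  = L (xi (vf_applyV L X e p)) f p + L (X p) (L (xi (e p)) f) p.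
Proof.
move=> se sf; have DX := lie_of_derivation HL (X p).
have sL x : smooth_fun (L x f) by case: (lie_of_derivation HL x) => + _ _; exact.
have LxiE v q : L (xi v) f q = \sum_(i < \dim {:V})
    coord (vbasis {:V}) i v * L (xi (vbasis {:V})`_i) f q.
  rewrite -lie_of_sum // {1}(coord_vbasis (memvf v)) linear_sum.
  by congr L; apply: eq_bigr => i _; rewrite linearZ.
have -> : vf_apply L (xi \o e) f = (fun q => \sum_(i < \dim {:V})
    coord (vbasis {:V}) i (e q) * L (xi (vbasis {:V})`_i) f q).
  by apply/funext => q; exact: LxiE.
rewrite {1}/vf_apply (derivation_sum DX) => [|i]; last first.
  by apply: smoothM => //; exact: smooth_coord.
rewrite lfun_vf_applyV lie_of_sum //.
have -> : L (xi (e p)) f = (fun q => \sum_(i < \dim {:V})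
    coord (vbasis {:V}) i (e p) * L (xi (vbasis {:V})`_i) f q).
  by apply/funext => q; exact: LxiE.
rewrite (derivation_sum DX) => [|i]; last by apply: smoothM => //; exact: smooth_cst.
rewrite -big_split; apply: eq_bigr => i _ /=; rewrite (derivationZ DX) //.
by case: DX => _ _ ->//; exact: smooth_coord.
Qed.

End LeftInvariantCalculus.

(** * The shear conditions in algebraic form *)

Section AlgebraicConditions.
Variables (R : realType) (g : lieAlgType R) (D : shear_data g).

(** Here xi (gamma X z) = [X, xi z] is condition (iii) evaluated on constant
sections. It also gives the torsion condition (i): on constant sections both
sides of (i) are brackets of elements of the abelian subalgebra xi(aG). *)
Lemma shear_conditions_of_gamma :
  (forall z1 z2, sh_omega D (sh_xi D z1) (sh_xi D z2) = 0) ->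
  (forall x z, sh_xi D (shear_gamma x z) = [lie x, sh_xi D z]) ->
  shear_conditions D.
Proof.
move=> omega0 xi_gamma; split=> // n G L _ HL.
have xiE v x z : sh_xi D (v + shear_gamma x z) = sh_xi D v + [lie x, sh_xi D z].
  by rewrite linearD /= xi_gamma.
split.
  move=> e1 e2 se1 se2 xe1 xe2 f sf p; rewrite /vf_commutator.
  (* Left: the two terms with differentiated coefficients, plus the field of
     [xi e1, xi e2], which is zero as aG is abelian. *)
  rewrite !(vf_apply_apply HL) // opprD addrACA -(lie_of_bracket HL) //.
  rewrite -sh_xi_morphism sh_aG_abelian linear0.
  rewrite [X in _ = X]/vf_apply /shear_nabla linearB /= !xiE.
  rewrite /xe1 /xe2 /= -!sh_xi_morphism !sh_aG_abelian linear0 !addr0.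
  rewrite [in RHS]addrC -[in RHS]scaleN1r !(lie_of_linear HL) // mulN1r.
  have L0 := lie_of_sum HL (I := 'I_0) (fun=> 0) (fun=> 0) p sf.
  by rewrite !big_ord0 in L0; rewrite L0 addr0 addrC.
move=> alpha X e sX se p; rewrite /shear_lie_nabla /shear_nabla_dual.
rewrite (vf_apply_lfun HL) // /shear_nabla linearD /= opprD addrA subrr add0r.
rewrite comp_lfunE xi_gamma /ce_d1 -opprD -linearD /= (lie_antisym (X p)) addNr.
by rewrite linear0 oppr0.
Qed.

End AlgebraicConditions.

(** * Two extensions of the same quotient are shears of each other *)

Section AbelianLie.
Variables (R : fieldType) (V : vectType R).

Definition abelian_lie : Type := V.
HB.instance Definition _ := Vector.on abelian_lie.

Fact abelian_lie_linear (k : R) (x y z : abelian_lie) :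
  0 = k *: 0 + 0 :> abelian_lie.
Proof. by rewrite scaler0 addr0. Qed.

Fact abelian_lie_jacobi (x y z : abelian_lie) : 0 + 0 + 0 = 0 :> abelian_lie.
Proof. by rewrite !addr0. Qed.

HB.instance Definition _ := Vector_isLieAlgebra.Build R abelian_lie
  abelian_lie_linear abelian_lie_linear (fun=> erefl) abelian_lie_jacobi.

Lemma abelian_lieP : lie_abelian abelian_lie.
Proof. by move=> x y. Qed.

End AbelianLie.

Section ShearAlongIdeal.
Variables (R : realType) (g h : lieAlgType R).
Variables (s : 'Hom(g, h)) (t : 'Hom(h, g)) (V : {vspace g}).
Hypotheses (sK : cancel s t) (tK : cancel t s).
Hypothesis ideal_V : forall x v, v \in V -> [lie x, v] \in V.
Hypothesis abel_V : forall u v, u \in V -> v \in V -> [lie u, v] = 0.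
Hypothesis abel_sV : forall u v, u \in V -> v \in V -> [lie s u, s v] = 0.
Hypothesis quot_s : forall x y, t [lie s x, s y] - [lie x, y] \in V.

(* b is the bracket of h transported to g. The shear data live on aG = aP = V
   with a the identity and xi the inclusion:
     eta(x) z = b x z,   omega(x, y) = b x y - [x, y].
   The quotient map p -> h is (x, z) |-> s (x - z), so aP enters h through
   - s; with this sign its kernel is the image of z |-> (xi z, a z). *)
Let b (x y : g) : g := t [lie s x, s y].
Let A := abelian_lie (subvs_of V).

Let bDl x y z : b (x + y) z = b x z + b y z.
Proof. by rewrite /b linearD lieDl linearD. Qed.
Let bDr x y z : b z (x + y) = b z x + b z y.
Proof. by rewrite /b linearD lieDr linearD. Qed.
Let bNl x z : b (- x) z = - b x z.
Proof. by rewrite /b linearN lieNl linearN. Qed.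
Let bNr x z : b z (- x) = - b z x.
Proof. by rewrite /b linearN lieNr linearN. Qed.
Let bZl k x z : b (k *: x) z = k *: b x z.
Proof. by rewrite /b linearZ lieZl linearZ. Qed.
Let bZr k x z : b z (k *: x) = k *: b z x.
Proof. by rewrite /b linearZ lieZr linearZ. Qed.
Let bC x y : b x y = - b y x.
Proof. by rewrite /b lie_antisym linearN. Qed.
Let b_ideal x v : v \in V -> b x v \in V.
Proof. by move=> Vv; rewrite -(subrK [lie x, v] (b x v)) memvD ?ideal_V ?quot_s. Qed.
Let b_abel u v : u \in V -> v \in V -> b u v = 0.
Proof. by move=> Vu Vv; rewrite /b abel_sV // linear0. Qed.
Let b_jacobi x y z : b x (b y z) + b y (b z x) + b z (b x y) = 0.
Proof. by rewrite /b !tK -!linearD lie_jacobi linear0. Qed.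
(* The two brackets differ by an element of V, which acts trivially on V; hence
   eta is a representation of g although b is not its bracket. *)
Let b_lie x y v : v \in V -> b [lie x, y] v = b (b x y) v.
Proof.
move=> Vv; apply/eqP; rewrite eq_sym -subr_eq0 -bNl -bDl.
by rewrite (b_abel (quot_s x y) Vv).
Qed.

Let eta_fun (x : g) (z : A) : A := vsproj V (b x (vsval z)).

Let eta_fun_linear x : linear (eta_fun x).
Proof. by move=> k u v; rewrite /eta_fun linearP bDr bZr linearP. Qed.
HB.instance Definition _ x :=
  GRing.isLinear.Build R A A _ (eta_fun x) (eta_fun_linear x).

Let eta_end (x : g) : 'End(A) := linfun (eta_fun x).

Let eta_end_linear : linear eta_end.
Proof.
move=> k x y; apply/lfunP => z; rewrite add_lfunE scale_lfunE !lfunE /=.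
by rewrite /eta_fun bDl bZl linearP.
Qed.
HB.instance Definition _ :=
  GRing.isLinear.Build R g 'End(A) _ eta_end eta_end_linear.

Let eta : 'Hom(g, 'End(A)) := linfun eta_end.

Let omega (x y : g) : A := vsproj V (b x y - [lie x, y]).

Let valA_inj (u v : A) : vsval u = vsval v -> u = v.
Proof. exact: (can_inj (@vsvalK _ _ _)). Qed.
Let valAD (u v : A) : vsval (u + v : A) = vsval u + vsval v.
Proof. exact: (linearD (@vsval _ _ V)). Qed.
Let valAN (u : A) : vsval (- u : A) = - vsval u.
Proof. exact: (linearN (@vsval _ _ V)). Qed.

Let valAZ k (u : A) : vsval (k *: u : A) = k *: vsval u.
Proof. exact: (linearZ_LR (@vsval _ _ V)). Qed.

Let etaE x (z : A) : vsval (eta x z) = b x (vsval z).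
Proof. by rewrite lfunE /= lfunE /= vsprojK // b_ideal // subvsP. Qed.

Let omegaE x y : vsval (omega x y) = b x y - [lie x, y].
Proof. by apply: vsprojK; exact: quot_s. Qed.

Let eta_rep x y (z : A) : eta [lie x, y] z = eta x (eta y z) - eta y (eta x z).
Proof.
apply: valA_inj; rewrite valAD valAN !etaE b_lie ?subvsP //.
have := b_jacobi x y (vsval z); rewrite (bC (vsval z) (b x y)) (bC (vsval z) x).
by rewrite bNr => /eqP; rewrite subr_eq0 => /eqP ->.
Qed.

Let omega_linearl y : linear (fun x => omega x y).
Proof.
move=> k x z; apply: valA_inj; rewrite valAD valAZ !omegaE bDl bZl lie_linearl.
by rewrite scalerBr opprD addrACA.
Qed.

Let omega_linearr x : linear (omega x).
Proof.
move=> k y z; apply: valA_inj; rewrite valAD valAZ !omegaE bDr bZr lie_linearr.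
by rewrite scalerBr opprD addrACA.
Qed.

Let omega_alternating x : omega x x = 0.
Proof. by rewrite /omega /b !lie_alternating linear0 subrr linear0. Qed.

Let domega x y z : ce_d2 omega x y z = - wedge12 eta omega x y z.
Proof.
apply: valA_inj; rewrite /ce_d2 /wedge12 !(valAD, valAN).
rewrite !etaE !omegaE !bDr !bNr (bC [lie x, y]) (bC [lie x, z]) (bC [lie y, z]).
(* The terms mixing b with the bracket of g agree on both sides; what remains
   is the Jacobi sum of g on the left and that of b on the right. *)
have negate (p q r : g) : p - q + r = 0 -> - p + q - r = 0.
  by move=> pqr; rewrite -[RHS]oppr0 -pqr !opprD opprK.
have := b_jacobi x y z; rewrite (bC z x) bNr => /negate Jb.
have := lie_jacobi x y z; rewrite (lie_antisym z x) lieNr => /negate Jl.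
rewrite (lie_antisym [lie x, y]) (lie_antisym [lie x, z]) (lie_antisym [lie y, z]).
rewrite !opprD !opprK !addrA.
rewrite [LHS](ACl ((5*3*1)*(6*4*2)))/= Jl addr0.
by rewrite [RHS](ACl ((2*4*6)*(1*3*5)))/= Jb addr0.
Qed.

Let xi : 'Hom(A, g) := linfun (vsval : subvs_of V -> g).
Let xiE (z : A) : xi z = vsval z. Proof. by rewrite lfunE. Qed.

Let xi_morphism : lie_morphism xi.
Proof. by move=> u v; rewrite linear0 !xiE abel_V // subvsP. Qed.

Let xi_injective : injective xi.
Proof. by move=> u v; rewrite !xiE => /valA_inj. Qed.

Let id_bijective : bijective (\1%VF : 'Hom(A, A)).
Proof. by exists id => x; rewrite id_lfunE. Qed.

Let D : shear_data g := ShearData (@abelian_lieP _ _) (@abelian_lieP _ _) erefl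
  eta_rep omega_linearl omega_linearr omega_alternating domega
  xi_morphism xi_injective id_bijective.

Let gamma_xi (x : g) (z : A) : xi (@shear_gamma R g D x z) = [lie x, xi z].
Proof.
have id_inv (w : A) : (\1%VF : 'Hom(A, A))^-1%VF w = w.
  have := lker0_lfunK (f := \1%VF : 'Hom(A, A)) _ w.
  by rewrite id_lfunE; apply; apply/lker0P => u v; rewrite !id_lfunE.
rewrite /shear_gamma /= !id_inv !xiE id_lfunE valAD omegaE etaE.
by rewrite (bC (vsval z)) (lie_antisym (vsval z)) opprK addrAC addNr add0r.
Qed.

Let pi_fun (u : shear_ext D) : h := s (u.1 - vsval (u.2 : A)).

Let pi_fun_linear : linear pi_fun.
Proof.
move=> k [u1 u2] [v1 v2]; rewrite /pi_fun -linearP; congr (s _) => /=.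
by rewrite scalerBr opprD addrACA.
Qed.
HB.instance Definition _ :=
  GRing.isLinear.Build R (shear_ext D) h _ pi_fun pi_fun_linear.

(** By the hypotheses s identifies g/V with h/s(V) as Lie algebras, and both
ideals are abelian. Neither the action on V nor the extension class is
constrained, since eta and omega can absorb any change in them. *)
Lemma is_shear_along_ideal : is_shear g h.
Proof.
exists D; split.
  apply: shear_conditions_of_gamma; last exact: gamma_xi.
  move=> z1 z2; apply: valA_inj; rewrite omegaE !xiE b_abel ?abel_V ?subvsP //.
  by rewrite subrr.
exists (linfun pi_fun); split.
- move=> [u1 u2] [v1 v2]; rewrite !lfunE /pi_fun /=.
  apply: (can_inj tK); rewrite sK -/(b _ _) !(valAD, valAN) omegaE !etaE.
  rewrite !bDl !bDr !bNl !bNr (b_abel (subvsP _) (subvsP _)).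
  rewrite (bC v1) !opprD !opprK /= addr0 !addrA.
  by rewrite [_ + b u1 v1]addrC addrK.
- by move=> y; exists (t y, 0); rewrite lfunE /= /pi_fun /= subr0 tK.
- move=> [u1 u2]; rewrite lfunE /= /pi_fun /=; split=> [/(congr1 t)|[z [-> ->]]].
    rewrite sK linear0 => /eqP; rewrite subr_eq0 => /eqP u1E.
    by exists u2; rewrite /shear_xi_ring /= id_lfunE xiE u1E.
  by rewrite xiE id_lfunE subrr linear0.
Qed.

End ShearAlongIdeal.

(** * Splitting off an abelian ideal *)

Section SplitLie.
Variables (R : fieldType) (g : lieAlgType R) (A : {vspace g}).
Hypothesis ideal_A : forall x a, a \in A -> [lie x, a] \in A.

Let P : 'End(g) := (\1 - projv A)%VF.

Let PE x : P x = x - projv A x.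
Proof. by rewrite add_lfunE opp_lfunE id_lfunE. Qed.

Let P_ideal a : a \in A -> P a = 0.
Proof. by move=> Aa; rewrite PE projv_id // subrr. Qed.

(* The Jacobi identity survives the projection by this identity, which holds
   because the kernel A of P is an ideal. *)
Let P_lie x y : P [lie x, P y] = P [lie x, y].
Proof.
by rewrite [P y]PE lieDr lieNr linearB /= (P_ideal (ideal_A _ (memv_proj _ _))) subr0.
Qed.

(** The direct sum of g/A and the abelian Lie algebra A. It is kept on the
underlying space of g, with the bracket P [x, y]: the complement of A cut out
by P stands for g/A. With this choice the identity map of g can serve as the
bijection in [is_shear_along_ideal]. *)
Definition split_lie of (forall x a, a \in A -> [lie x, a] \in A) : Type := g.
Local Notation split_A := (split_lie ideal_A).
HB.instance Definition _ := Vector.on split_A.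

Let br (x y : split_A) : split_A := P [lie (x : g), (y : g)].

Fact split_lie_linearl k (x y z : split_A) : br (k *: x + y) z = k *: br x z + br y z.
Proof. by rewrite /br lie_linearl linearP. Qed.

Fact split_lie_linearr k (x y z : split_A) : br z (k *: x + y) = k *: br z x + br z y.
Proof. by rewrite /br lie_linearr linearP. Qed.

Fact split_lie_alternating (x : split_A) : br x x = 0.
Proof. by rewrite /br lie_alternating linear0. Qed.

Fact split_lie_jacobi (x y z : split_A) :
  br x (br y z) + br y (br z x) + br z (br x y) = 0.
Proof. by rewrite /br !P_lie -!linearD lie_jacobi linear0. Qed.

HB.instance Definition _ := Vector_isLieAlgebra.Build R split_A
  split_lie_linearl split_lie_linearr split_lie_alternating split_lie_jacobi.

Lemma split_lieE (x y : split_A) :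
  [lie x, y] = [lie (x : g), (y : g)] - projv A [lie (x : g), (y : g)].
Proof. exact: PE. Qed.

Lemma split_lie_ideal (x a : split_A) : a \in A -> [lie x, a] = 0.
Proof. by move=> Aa; apply: P_ideal; exact: ideal_A. Qed.

(** P is a morphism from g to the split algebra, and it carries the derived
series of g onto that of the split algebra from the first derived algebra on;
at the start it fails to be onto, whence the successor. *)
Lemma derived_series_split_lie k :
  derived_series g k.+1 = A -> derived_series split_A k.+1 = 0%VS.
Proof.
move=> DA; suff sub j : (derived_series split_A j.+1 <= P @: derived_series g j.+1)%VS.
  apply/eqP; rewrite -subv0; apply: subv_trans (sub k) _; rewrite DA.
  by apply/subvP => _ /memv_imgP[a Aa ->]; rewrite P_ideal ?mem0v.
elim: j => [|j IHj].
  apply/liev_prodP => u v _ _; apply: (memv_img P).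
  by apply: (liev_prodP _ _ _ (subvv _)); exact: memvf.
apply/liev_prodP => u v /(subvP IHj)/memv_imgP[u' Du ->].
move=> /(subvP IHj)/memv_imgP[v' Dv ->].
have -> : [lie (P u' : split_A), (P v' : split_A)] = P [lie u', v'].
  rewrite [LHS]P_lie lie_antisym linearN /= P_lie -linearN -lie_antisym //.
apply: (memv_img P).
exact: (liev_prodP _ _ _ (subvv _)).
Qed.

End SplitLie.

Section DerivedSeries.
Variables (R : fieldType) (g : lieAlgType R).

HB.instance Definition _ (x : g) :=
  GRing.isLinear.Build R g g _ (lie_bracket x) (fun k u v => lie_linearr k u v x).

Lemma derived_series_ideal k (x a : g) :
  a \in derived_series g k -> [lie x, a] \in derived_series g k.
Proof.
elim: k x a => [|k IHk] x a; first by move=> _; exact: memvf.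
have mem u v : u \in derived_series g k -> v \in derived_series g k ->
    [lie u, v] \in derived_series g k.+1.
  exact: (liev_prodP _ _ _ (subvv _)).
suff /subvP sub : (derived_series g k.+1 <=
    linfun (lie_bracket x) @^-1: derived_series g k.+1)%VS.
  by move=> /sub; rewrite -memv_preim lfunE.
apply/liev_prodP => u v Du Dv; rewrite -memv_preim lfunE /=.
have /eqP := lie_jacobi x u v; rewrite -addrA addr_eq0 => /eqP ->.
by rewrite memvN (lie_antisym v x) lieNr memvD ?memvN ?mem ?IHk.
Qed.

End DerivedSeries.

(** * Sequences of shears *)

Section ShearSequences.
Variable R : realType.
Implicit Types g h : lieAlgType R.

Definition shear_sequence g h : Prop :=
  exists (N : nat) (c : nat -> lieAlgType R),
    [/\ c 0%N = g, forall i : nat, (i < N)%N -> is_shear (c i) (c i.+1) & c N = h].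

Lemma shear_sequence_refl g : shear_sequence g g.
Proof. by exists 0%N, (fun=> g). Qed.

Lemma is_shear_sequence g h : is_shear g h -> shear_sequence g h.
Proof.
by move=> gh; exists 1%N, (fun i => if i is 0 then g else h); split=> // -[].
Qed.

Lemma shear_sequence_trans h g k :
  shear_sequence g h -> shear_sequence h k -> shear_sequence g k.
Proof.
move=> [N [c [<- cS cN]]] [M [d [d0 dS <-]]].
exists (N + M)%N, (fun i => if (i < N)%N then c i else d (i - N)%N); split.
- by case: N cN {cS} => [cN|//]; rewrite ltnn d0 -cN.
- move=> i iNM; case: (ltnP i N) => [iN|Ni].
    move: (cS i iN); case: (ltnP i.+1 N) => // Ni1.
    have <- : N = i.+1 by apply/eqP; rewrite eqn_leq Ni1.
    by rewrite cN subnn d0.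
  by rewrite ltnNge (leq_trans Ni) //= subSn //; apply: dS; rewrite ltn_subLR.
- by rewrite ltnNge leq_addr /= addKn.
Qed.

Lemma vect_iso_of_dim (U W : vectType R) : \dim {:U} = \dim {:W} ->
  exists (s : 'Hom(U, W)) (t : 'Hom(W, U)), cancel s t /\ cancel t s.
Proof.
move=> dimUW; have [f fP] := linear_of_free (vbasis {:U}) (vbasis {:W}).
have {}fP : map f (vbasis {:U}) = vbasis {:W}.
  by apply: fP; [exact: basis_free (vbasisP _)|rewrite !size_tuple].
pose s := linfun f.
have limg_s : limg s = fullv.
  rewrite -(span_basis (vbasisP {:U})) limg_span.
  rewrite (eq_map (lfunE f)) fP; exact: span_basis (vbasisP _).
have ker_s : lker s == 0%VS.
  rewrite -dimv_eq0 -(eqn_add2r (\dim (limg s))).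
  by have := limg_ker_dim s fullv; rewrite capfv => ->; rewrite limg_s add0n dimUW.
exists s, (s^-1)%VF; split; first exact: lker0_lfunK.
by move=> y; apply: limg_lfunVK; rewrite limg_s memvf.
Qed.

Lemma is_shear_abelian g h : \dim {:g} = \dim {:h} ->
  lie_abelian g -> lie_abelian h -> is_shear g h.
Proof.
move=> /vect_iso_of_dim[s [t [sK tK]]] ab_g ab_h.
apply: (is_shear_along_ideal (V := fullv) sK tK) => *; rewrite ?memvf //.
Qed.

Lemma is_shear_split_lie g (A : {vspace g})
    (ideal_A : forall x a, a \in A -> [lie x, a] \in A)
    (abel_A : forall u v, u \in A -> v \in A -> [lie u, v] = 0) :
  is_shear g (split_lie ideal_A) /\ is_shear (split_lie ideal_A) g.
Proof.
have oneK (W : vectType R) : cancel (\1%VF : 'End(W)) (\1%VF : 'End(W)).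
  by move=> w; rewrite !id_lfunE.
split.
- apply: (@is_shear_along_ideal R g (split_lie ideal_A) \1%VF \1%VF A) => //.
  + exact: oneK.
  + exact: oneK.
  + by move=> u v _ Av; rewrite !id_lfunE split_lie_ideal.
  + by move=> x y; rewrite !id_lfunE split_lieE addrAC subrr add0r memvN memv_proj.
- apply: (@is_shear_along_ideal R (split_lie ideal_A) g \1%VF \1%VF A) => //.
  + exact: oneK.
  + exact: oneK.
  + by move=> x v Av; rewrite split_lie_ideal ?mem0v.
  + by move=> u v _ Av; rewrite split_lie_ideal.
  + by move=> u v Au Av; rewrite !id_lfunE abel_A.
  + by move=> x y; rewrite !id_lfunE split_lieE opprB addrC subrK memv_proj.
Qed.

Lemma derived_series_eq0_bracket g k u v : derived_series g k.+1 = 0%VS ->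
  u \in derived_series g k -> v \in derived_series g k -> [lie u, v] = 0.
Proof.
move=> D0 Du Dv; apply/eqP; rewrite -memv0 -D0.
exact: (liev_prodP _ _ _ (subvv _)).
Qed.

(** Induction on the derived length: splitting off the last term A of the
derived series shortens it by one. Both directions are needed, since one of the
two given algebras is left and the other one is reached. *)
Lemma solvable_shear_abelian k g : derived_series g k.+1 = 0%VS ->
  exists a : lieAlgType R, [/\ lie_abelian a, \dim {:a} = \dim {:g},
    shear_sequence g a & shear_sequence a g].
Proof.
elim: k g => [|k IHk] g D0.
  exists g; split=> //; try exact: shear_sequence_refl.
  by move=> x y; apply: derived_series_eq0_bracket D0 _ _; exact: memvf.
have ideal_D := @derived_series_ideal R g k.+1.
have [a [ab_a dim_a ga ag]] :=
  IHk (split_lie ideal_D) (derived_series_split_lie ideal_D erefl).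
have [gs sg] := is_shear_split_lie ideal_D (fun u v => derived_series_eq0_bracket D0).
exists a; split=> //.
- exact: shear_sequence_trans (is_shear_sequence gs) ga.
- exact: shear_sequence_trans ag (is_shear_sequence sg).
Qed.

Lemma lie_isomorphic_refl g : lie_isomorphic g g.
Proof.
exists \1%VF; split; first by exists id => x; rewrite id_lfunE.
by move=> x y; rewrite !id_lfunE.
Qed.

Lemma lie_solvableS g : lie_solvable g -> exists k, derived_series g k.+1 = 0%VS.
Proof.
move=> [k D0]; exists k; apply/eqP; rewrite -subv0.
rewrite -[derived_series g k.+1]/(liev_prod (derived_series g k) _) D0.
by apply/liev_prodP => u v; rewrite !memv0 => /eqP -> _; rewrite lie0l.
Qed.

End ShearSequences.

Theorem proposition2p5 (R : realType) (s s' : lieAlgType R)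
    (hs : lie_solvable s) (hs' : lie_solvable s')
    (hdim : \dim {: s} = \dim {: s'}) :
  exists (N : nat) (g : nat -> lieAlgType R),
    [/\ g 0%N = s,
        forall i : nat, (i < N)%N -> is_shear (g i) (g i.+1) &
        lie_isomorphic (g N) s'].
Proof.
have [k Dk] := lie_solvableS hs; have [k' Dk'] := lie_solvableS hs'.
have [a [ab_a dim_a sa _]] := solvable_shear_abelian Dk.
have [a' [ab_a' dim_a' _ a's']] := solvable_shear_abelian Dk'.
have aa' : is_shear a a' by apply: is_shear_abelian; rewrite // dim_a hdim.
have [N [g [g0 gS gN]]] : shear_sequence s s'.
  apply: shear_sequence_trans sa (shear_sequence_trans _ a's').
  exact: is_shear_sequence.
by exists N, g; split=> //; rewrite gN; exact: lie_isomorphic_refl.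
Qed.
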